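(* Let $\mathbb{K}=(G,M,I)$ be a formal context with $G$ finite, let $m\in M$, and put $R=m^{(I)}$. Suppose $\mathcal{S}$ is a representative system of $R$-mixed generators in $\mathbb{K}$ which has the semi-downset property. If $m$ does not correspond to a full column (i.e. $R\neq\emptyset$), then there exists an object $g\in R$ such that $|\mathcal{B}|\geq|\mathcal{C}^{\neg R}|$, where $\mathcal{B}$ and $\mathcal{C}^{\neg R}$ are the classes of $\mathcal{S}$ defined with respect to $\mathbb{L}=\mathrm{op}^{g,m}(\mathbb{K})$.
   Context: A formal context is $(G,M,I)$ with $I\subseteq G\times M$. For $A\subseteq G$, $A^I=\{n\in M:(a,n)\in I\ \forall a\in A\}$ and dually for $B\subseteq M$; the same notation is used for other incidence relations. For $n\in M$, $n^{(I)}:=G\setminus n^I$. For $(g,m)\notin I$, $\mathrm{op}^{g,m}(\mathbb{K})=(G,M,J)$ with $J=I\cup\{(g,n):n\in M\setminus\{m\}\}\cup\{(h,m):h\in G\setminus\{g\}\}$. For $R\subseteq G$, $S\subseteq G$ is an $R$-mixed generator in $(G,M,I)$ if for every $h\in G$: (i) $h\in S\cap R\Rightarrow(S\setminus\{h\})^{II}\neq S^{II}$; (ii) $h\notin S\cup R\Rightarrow(S\cup\{h\})^{II}\neq S^{II}$; an $R$-mixed generator in $(G,M,J)$ is defined identically with $J$ and the same $R$. A representative system of $R$-mixed generators is a family $\mathcal{S}$ of $R$-mixed generators on which $S\mapsto S^{II}$ is injective. It has the semi-downset property if $S\in\mathcal{S}$ and $T\subseteq R$ imply $S\setminus T\in\mathcal{S}$.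 Given $g\in R$ and $\mathbb{L}=(G,M,J)=\mathrm{op}^{g,m}(\mathbb{K})$: $\mathcal{N}=\{S\in\mathcal{S}:S\text{ is not an }R\text{-mixed generator in }\mathbb{L}\}$; $\mathcal{B}=\{S\in\mathcal{S}\setminus\mathcal{N}:S^J\neq S^I,\ (S\cup\{g\})^J=S^I\}$; $\mathcal{C}=\{S\in\mathcal{S}\setminus\mathcal{N}:S^J\neq S^I,\ (S\cup\{g\})^J\neq S^I\}$; $\mathcal{C}^{\neg R}=\{S\in\mathcal{C}:R\not\subseteq S\}$. *)

(* Defs.v *)
From mathcomp Require Import all_boot.
From mathcomp Require Import boolp classical_sets.

Set Implicit Arguments.
Unset Strict Implicit.
Unset Printing Implicit Defensive.

(* A formal context (G, M, I) is a finite type G of objects, an arbitrary type M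
   of attributes and an incidence relation I : G -> M -> Prop.  Since M may be
   infinite, sets of attributes are classical sets [set M], while sets of
   objects are finite sets [{set G}]. *)

Section FormalContext.
Variables (G : finType) (M : Type).
Implicit Types (I J : G -> M -> Prop) (A R S T : {set G}) (B : set M).
Implicit Types (SS : {set {set G}}).

(* [intent I A] is A^I and [extent I B] is B^I. *)
Definition intent I A : set M :=
  (fun n => forall a, a \in A -> I a n).

Definition extent I B : {set G} :=
  [set a | `[< forall n, B n -> I a n >]].

(* A^{II} *)
Definition object_closure I A : {set G} := extent I (intent I A).

(* n^{(I)} = G \ n^I *)
Definition nonincident I (n : M) : {set G} := ~: extent I [set n]%classic.

(* The incidence relation of op^{g,m}(G, M, I); only meaningful when
   (g, m) is not in I. *)
Definition op_incidence I (g : G) (m : M) : G -> M -> Prop :=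
  fun h n => [\/ I h n, h = g /\ n <> m | h <> g /\ n = m].

Definition mixed_generator I R S : Prop :=
  forall h : G,
    (h \in S :&: R -> object_closure I (S :\ h) <> object_closure I S) /\
    (h \notin S :|: R -> object_closure I (h |: S) <> object_closure I S).

Definition representative_system I R SS : Prop :=
  (forall S, S \in SS -> mixed_generator I R S) /\
  {in SS &, injective (object_closure I)}.

Definition semi_downset R SS : Prop :=
  forall S T, S \in SS -> T \subset R -> S :\: T \in SS.

(* In the four classes below, J is meant to be [op_incidence I g m]. *)
Definition classN J R SS : {set {set G}} :=
  [set S in SS | `[< ~ mixed_generator J R S >]].

Definition classB I J R (g : G) SS : {set {set G}} :=
  [set S in SS :\: classN J R SS |
     `[< intent J S <> intent I S /\ intent J (g |: S) = intent I S >]].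

Definition classC I J R (g : G) SS : {set {set G}} :=
  [set S in SS :\: classN J R SS |
     `[< intent J S <> intent I S /\ intent J (g |: S) <> intent I S >]].

Definition classCnotR I J R (g : G) SS : {set {set G}} :=
  [set S in classC I J R g SS | ~~ (R \subset S)].

End FormalContext.

(* Main.v *)
Require Import Defs.
From mathcomp Require Import all_boot.
From mathcomp Require Import boolp.

(** Average over [g] in [R].  Call [S] robust if it meets [R] and every [h] in
    [S :&: R] is separated from [S :\ h] by an attribute other than [m].  For
    every [g] in [R], the members of [classC] are robust and contain [g], while
    each robust [S] avoiding [g] is in [classB].  Robust members of [SS] are
    stable under removing elements of [R] as long as the trace on [R] stays
    nonempty.  So it suffices to inject the pairs [(S, g)] with [S] robust,
    [g \in S :&: R] and [R] not inside [S] into the pairs with [S] robust and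
    [g \in R :\: S].  Send [(S, g)] to [(S :\ g, g)] unless [S :&: R = [set g]];
    in this case, add to [S] the successors of [g] in a fixed cyclic order of [R]
    until the next one, [g'], would give a set which is not robust or contains
    [R], and take the pair formed by the resulting set and [g']. *)

Set Implicit Arguments.
Unset Strict Implicit.
Unset Printing Implicit Defensive.

Lemma sum_card_pairs (G : finType) (R : {set G}) (P : {set G} -> G -> bool) :
  \sum_(g in R) #|[set S | P S g]|
    = #|[set p : {set G} * G | (p.2 \in R) && P p.1 p.2]|.
Proof.
rewrite -sum1_card (partition_big snd (mem R)) /=; last first.
  by move=> p; rewrite inE => /andP[].
apply: eq_bigr => g gR.
have pair_inj : injective (fun S : {set G} => (S, g)) by move=> S T [].
rewrite -(card_imset _ pair_inj) -sum1_card; apply: eq_bigl => -[S h].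
rewrite !inE /=; apply/imsetP/andP => [[T] | [/andP[hR PSh] /eqP hg]].
  by rewrite inE => PT [-> ->]; rewrite gR PT eqxx.
by exists S; rewrite ?inE -?hg.
Qed.

Section TraceDownset.
Variables (G : finType) (R : {set G}) (F : {set {set G}}).
Hypothesis F_down : forall S T : {set G},
  S \in F -> T \subset R -> (S :\: T) :&: R != set0 -> S :\: T \in F.

Local Notation succ := (next (enum R)).

Local Notation F_proper S := ((S \in F) && ~~ (R \subset S)).

Lemma succ_inj : injective succ.
Proof. exact: can_inj (prev_next (enum_uniq _)). Qed.

Lemma iter_succ_in k g : g \in R -> iter k succ g \in R.
Proof. by move=> gR; elim: k => //= k; rewrite -!(mem_enum R) mem_next. Qed.

Lemma traject_succ_cover g :
  g \in R -> exists k, R \subset [set x in traject succ g k.+1].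
Proof.
move=> gR; exists (order succ g).-1; rewrite orderSpred.
apply/subsetP => x xR; rewrite inE -/(orbit succ g) -fconnect_orbit.
by rewrite (fconnect_cycle (cycle_next (enum_uniq _))) mem_enum.
Qed.

Lemma traject_succ_sub g k : g \in R -> [set x in traject succ g k] \subset R.
Proof.
move=> gR; apply/subsetP => x; rewrite inE => /trajectP[i _ ->].
exact: iter_succ_in.
Qed.

Lemma arc_exit (S : {set G}) g : F_proper S -> S :&: R = [set g] ->
  exists k, let T := S :|: [set x in traject succ g k] in
    [/\ 0 < k, T \in F, iter k succ g \notin T
      & ~~ F_proper (iter k succ g |: T)].
Proof.
move=> FS SR; have /setIP[gS gR] : g \in S :&: R by rewrite SR set11.
pose T k := S :|: [set x in traject succ g k].
have TS k : T k.+1 = iter k succ g |: T k.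
  by rewrite /T trajectSr; apply/setP => x; rewrite !inE mem_rcons inE orbCA.
have exk : exists k, ~~ F_proper (T k.+1).
  have [k Rk] := traject_succ_cover gR; exists k.
  by rewrite negb_and negbK (subset_trans Rk) ?subsetUr ?orbT.
case: (ex_minnP exk) => -[|k] nFk mink.
  by move: nFk; rewrite TS /T /= set_nil setU0 (setUidPr _) ?FS // sub1set.
have FTk : F_proper (T k.+1).
  by apply: contraT => /mink; rewrite ltnn.
exists k.+1; split => //; first by case/andP: FTk.
  apply: contra nFk => kT; rewrite TS.
  by rewrite (setUidPr _) ?FTk // sub1set.
by rewrite -TS.
Qed.

Definition arc_of (p q : {set G} * G) k :=
  [/\ p.1 :&: R = [set p.2], q.2 = iter k succ p.2,
      q.1 = p.1 :|: [set x in traject succ p.2 k] & 0 < k].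

(** The added arc is [T :&: R], so its length tells how far to step back from
    the exit point to recover [g]. *)
Lemma arc_of_inj (p p' q : {set G} * G) k k' : q.2 \notin q.1 ->
  arc_of p q k -> arc_of p' q k' -> p = p'.
Proof.
case: p p' q => [S g] [S' g'] [T x] /= xT [/= SR xE TE k0] [/= SR' xE' TE' k0'].
have arc U h n : U :&: R = [set h] -> T = U :|: [set z in traject succ h n] ->
    0 < n -> x = iter n succ h ->
    [/\ T :\: R = U :\: R, h \in R & n = #|T :&: R|].
  move=> UR Tn n0 xn; have /setIP[hU hR] : h \in U :&: R by rewrite UR set11.
  have sR := traject_succ_sub n hR.
  split => //.
    by move: sR; rewrite -setD_eq0 Tn setDUl => /eqP->; rewrite setU0.
  rewrite Tn setIUl (setIidPl sR) UR (setUidPr _); last first.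
    by rewrite sub1set inE; case: (n) n0 => //= n' _; rewrite inE eqxx.
  have: uniq (traject succ h n.+1).
    rewrite looping_uniq; apply: contra xT => xn'.
    by rewrite Tn !inE xn [_ \in traject _ _ _]xn' orbT.
  rewrite trajectSr rcons_uniq => /andP[_ /card_uniqP].
  by rewrite cardsE size_traject => ->.
have [D gR kE] := arc _ _ _ SR TE k0 xE.
have [D' g'R kE'] := arc _ _ _ SR' TE' k0' xE'.
have gg : g = g'.
  move: xE'; rewrite xE kE kE'; elim: #|_| => //= n IHn /succ_inj; exact: IHn.
by rewrite -gg -(setID S R) -(setID S' R) SR SR' -D -D' gg.
Qed.

Lemma leq_sum_trace_downset :
  \sum_(g in R) #|[set S | [&& F_proper S & g \in S]]|
    <= \sum_(g in R) #|[set S in F | g \notin S]|.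
Proof.
rewrite !sum_card_pairs.
set P := [set p | _]; set Q := [set p | _].
(* The two kinds of images are told apart by putting the second component back
   into the first. *)
pose rel p q := if F_proper (q.2 |: q.1)
  then p = (q.2 |: q.1, q.2) else exists k, arc_of p q k.
have rel_inj p p' q : q \in Q -> rel p q -> rel p' q -> p = p'.
  rewrite !inE => /and3P[_ _ qq]; rewrite /rel; case: ifP => _; first by move=> -> ->.
  by move=> [k pk] [k' pk']; exact: arc_of_inj pk pk'.
have exq p : exists q, p \in P -> q \in Q /\ rel p q.
  have [pP|_] := boolP (p \in P); last by exists p.
  case: p pP => S g; rewrite inE => /= /and3P[gR FS gS].
  have [SgR|SgR] := eqVneq ((S :\ g) :&: R) set0; last first.
    exists (S :\ g, g) => _; split; last by rewrite /rel /= setD1K // FS.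
    by rewrite !inE /= gR eqxx /= andbT F_down ?sub1set //; case/andP: FS.
  have SR : S :&: R = [set g].
    by rewrite -(setD1K gS) setIUl SgR setU0; apply/setIidPl; rewrite sub1set.
  have [k [k0 FT kT nF]] := arc_exit FS SR.
  exists (S :|: [set x in traject succ g k], iter k succ g) => _; split.
    by rewrite inE /= iter_succ_in // FT.
  by rewrite /rel /= (negbTE nF); exists k.
have [f fP] := fin_all_exists exq.
have f_inj : {in P &, injective f}.
  move=> p p' /fP[fQ rp] /fP[_ rp'] ff.
  by apply: rel_inj fQ rp _; rewrite ff.
rewrite -(card_in_imset f_inj); apply: subset_leq_card.
by apply/subsetP => _ /imsetP[p /fP[fQ _] ->].
Qed.

End TraceDownset.

Section Context.
Variables (G : finType) (M : Type) (I : G -> M -> Prop) (m : M).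
Implicit Types S T : {set G}.

Lemma nonincidentP (h : G) : reflect (~ I h m) (h \in nonincident I m).
Proof.
rewrite !inE; apply: (iffP idP) => [/asboolPn nI Ihm|nI].
  by apply: nI => n ->.
by apply/asboolPn => /(_ m erefl).
Qed.

Lemma closure_setU1 (J : G -> M -> Prop) S h :
  object_closure J (h |: S) = object_closure J S
    <-> (forall n, intent J S n -> J h n).
Proof.
split=> [cl n Sn|Sh].
  have: h \in object_closure J (h |: S).
    by rewrite inE; apply/asboolP => k; apply; exact: setU11.
  by rewrite cl inE => /asboolP; apply.
congr (extent J _); apply/predeqP => n; split=> [hSn a aS|Sn a].
  by apply: hSn; rewrite setU1r.
by rewrite in_setU1 => /predU1P[->|]; [exact: Sh | exact: Sn].
Qed.

Lemma mixed_generatorP (J : G -> M -> Prop) R S :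
  mixed_generator J R S <-> forall h : G,
    (h \in S :&: R -> exists2 n, intent J (S :\ h) n & ~ J h n) /\
    (h \notin S :|: R -> exists2 n, intent J S n & ~ J h n).
Proof.
have sep T h : object_closure J (h |: T) <> object_closure J T
    <-> exists2 n, intent J T n & ~ J h n.
  split=> [|[n Tn nJ] /closure_setU1 Th]; last exact: nJ (Th n Tn).
  apply: contra_notP => nsep; apply/closure_setU1 => n Tn.
  by apply: contrapT => nJ; apply: nsep; exists n.
split=> gen h; have [gen1 gen2] := gen h; (split; last by move=> /gen2/sep).
  by move=> hSR; apply/sep; rewrite setD1K; [exact/nesym/gen1|case/setIP: hSR].
move=> hSR; apply: nesym; rewrite -{1}(@setD1K _ h S); last by case/setIP: hSR.
exact/sep/gen1.
Qed.

Local Notation R := (nonincident I m).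

Definition robust (S : {set G}) := S :&: R != set0 /\
  forall h, h \in S :&: R -> exists n, [/\ n <> m, intent I (S :\ h) n & ~ I h n].

Lemma robust_setD S T : robust S -> (S :\: T) :&: R != set0 -> robust (S :\: T).
Proof.
move=> [_ rS] ne; split=> // h /setIP[/setDP[hS _] hR].
have [|n [nm Sn nI]] := rS h; first by rewrite inE hS.
exists n; split=> // a; rewrite !inE => /and3P[ah _ aS].
by apply: Sn; rewrite !inE ah.
Qed.

Variables (g : G) (gR : g \in R).

Local Notation J := (op_incidence I g m).

Lemma op_incidence_other h n : n <> m -> h <> g -> J h n <-> I h n.
Proof. by move=> nm hg; split=> [|Ihn]; [case=> [|[]|[]] | exact: Or31]. Qed.

Lemma op_incidence_self n : J g n <-> n <> m.
Proof.
split=> [[Ign nm|[]//|[]//]|nm]; last by apply: Or32.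
by move/nonincidentP: gR; rewrite -nm.
Qed.

Lemma intent_op_notin S n :
  g \notin S -> intent J S n <-> intent I S n \/ n = m.
Proof.
move=> gS; have Sg a : a \in S -> a <> g by move=> aS ag; rewrite -ag aS in gS.
split=> [Sn|[Sn|nm] a aS]; last 2 first.
- by apply: Or31; exact: Sn.
- by apply: Or33; split=> //; exact: Sg.
have [->|nm] := pselect (n = m); [by right | left=> a aS].
by apply/op_incidence_other => //; [exact: Sg | exact: Sn].
Qed.

Lemma intent_op_setU1 S n :
  intent J (g |: S) n <-> intent I (S :\ g) n /\ n <> m.
Proof.
split=> [Sn|[Sn nm] a].
  have nm : n <> m by apply/op_incidence_self/Sn/setU11.
  split=> // a /setD1P[/eqP ag aS].
  by apply/op_incidence_other => //; apply: Sn; exact: setU1r.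
have [-> _|/eqP ag] := eqVneq a g; first exact/op_incidence_self.
rewrite in_setU1 => /predU1P[//|aS]; apply: Or31; apply: Sn.
by rewrite !inE aS andbT; exact/eqP.
Qed.

Lemma intent_meet_neq S n h : h \in S :&: R -> intent I S n -> n <> m.
Proof.
by move=> /setIP[hS /nonincidentP nI] Sn nm; apply: nI; rewrite -nm; exact: Sn.
Qed.

Lemma robust_classB (SS : {set {set G}}) S : S \in SS -> mixed_generator I R S ->
  robust S -> g \notin S -> S \in classB I J R g SS.
Proof.
move=> SSS /mixed_generatorP gen [/set0Pn[h0 h0SR] rS] gS.
have genJ : mixed_generator J R S.
  apply/mixed_generatorP => h; have [_ gen2] := gen h; split=> [hSR|hSR].
    have [n [nm Sn nI]] := rS h hSR; exists n.
      by apply/intent_op_notin; [rewrite !inE negb_and gS orbT | left].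
    move/op_incidence_other => /(_ nm) Jh; apply: nI; apply: Jh => hg.
    by move: hSR gS; rewrite hg => /setIP[->].
  have [n Sn nI] := gen2 hSR; have [hS hR] : h \notin S /\ h \notin R.
    by apply/andP; rewrite -negb_or -in_setU.
  exists n; first by apply/intent_op_notin => //; left.
  move/op_incidence_other => Jh; apply: nI; apply: Jh => [nm|hg].
    by apply: (intent_meet_neq h0SR Sn).
  by rewrite hg gR in hR.
have SnN : S \in SS :\: classN J R SS.
  by rewrite !inE SSS andbT /=; apply/asboolPn; rewrite notK.
rewrite inE SnN; apply/asboolP; split.
  move=> eqJI; have : intent I S m by rewrite -eqJI; apply/intent_op_notin => //; right.
  by move/(intent_meet_neq h0SR).
apply/predeqP => n; rewrite intent_op_setU1.
have -> : S :\ g = S by apply/setDidPl; rewrite disjoint_sym disjoints1.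
by split=> [[]//|Sn]; split=> //; exact: intent_meet_neq h0SR Sn.
Qed.

Lemma classC_robust (SS : {set {set G}}) S : mixed_generator I R S ->
  S \in classC I J R g SS -> robust S /\ g \in S.
Proof.
move=> /mixed_generatorP gen; rewrite inE => /andP[_ /asboolP[neq neqg]].
have gS : g \in S.
  apply: contraT => gS; case: neqg; apply/predeqP => n.
  rewrite intent_op_setU1.
  have -> : S :\ g = S by apply/setDidPl; rewrite disjoint_sym disjoints1.
  split=> [[]//|Sn]; split=> // nm; apply: neq; apply/predeqP => k.
  by rewrite intent_op_notin // ; split=> [[|->]|]; [|rewrite -nm|left].
split=> //; split; first by apply/set0Pn; exists g; rewrite inE gS.
move=> h hSR; have [hg|hg] := eqVneq h g.
  apply: contrapT => nsep; apply: neqg; apply/predeqP => n.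
  rewrite intent_op_setU1; split=> [[Sn nm] a aS|Sn].
    have [->|ag] := eqVneq a g; last by apply: Sn; rewrite !inE ag.
    by apply: contrapT => nI; apply: nsep; exists n; rewrite hg.
  split; last exact: intent_meet_neq hSR Sn.
  by move=> a /setD1P[_ aS]; exact: Sn.
have [/(_ hSR)[n Sn nI] _] := gen h; exists n; split=> //.
by apply: (@intent_meet_neq (S :\ h) n g _ Sn); rewrite in_setI gR in_setD1 eq_sym hg gS.
Qed.

End Context.

Theorem theorem4 (G : finType) (M : Type) (I : G -> M -> Prop) (m : M)
    (R : {set G}) (hR : R = nonincident I m)
    (SS : {set {set G}})
    (hrep : representative_system I R SS)
    (hdown : semi_downset R SS)
    (hfull : R != set0) :
  exists g : G, g \in R /\
    #|classCnotR I (op_incidence I g m) R g SS| <= #|classB I (op_incidence I g m) R g SS|.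
Proof.
have [gen _] := hrep; subst R.
set R := nonincident I m in hdown hfull gen *.
pose F := [set S in SS | `[< robust I m S >]].
have F_down (S T : {set G}) : S \in F -> T \subset R -> (S :\: T) :&: R != set0 -> S :\: T \in F.
  rewrite !inE => /andP[SSS /asboolP rS] TR ne.
  by rewrite hdown //=; apply/asboolP; exact: robust_setD.
have := leq_sum_trace_downset F_down.
apply: contraTP => noex; rewrite -ltnNge.
have lt_BC g : g \in R -> #|[set S in F | g \notin S]|
    < #|[set S | [&& (S \in F) && ~~ (R \subset S) & g \in S]]|.
  move=> gR; have : ~~ (#|classCnotR I (op_incidence I g m) R g SS| <=
      #|classB I (op_incidence I g m) R g SS|).
    by apply/negP => le; apply: noex; exists g.
  rewrite -ltnNge => lt_BC; apply: leq_ltn_trans (leq_trans lt_BC _).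
    apply: subset_leq_card; apply/subsetP => S.
    move=> /setIdP[/setIdP[SSS /asboolP rS] gS].
    exact: (robust_classB gR SSS (gen S SSS) rS gS).
  apply: subset_leq_card; apply/subsetP => S; rewrite inE => /andP[CS nRS].
  have SSS : S \in SS by move: CS; rewrite !inE => /andP[/andP[]].
  have [rS gS] := classC_robust gR (gen S SSS) CS.
  by rewrite !inE SSS nRS gS !andbT; apply/asboolP.
have [g0 g0R] := set0Pn _ hfull.
rewrite [ltnLHS](bigD1 g0) // [ltnRHS](bigD1 g0) //=.
rewrite -addSn leq_add ?lt_BC //.
by apply: leq_sum => g /andP[gR _]; exact/ltnW/lt_BC.
Qed.
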